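(* Let $(X,d)$ and $(Y,d')$ be two invariant metric groups, with group completions $(\overline{X},\overline{d})$ and $(\overline{Y},\overline{d'})$. Let $\Phi$ be a map from $(Lip^1_+(X),\oplus,\rho)$ into $(Lip^1_+(Y),\oplus,\rho)$. Then the following assertions are equivalent. (1) $\Phi$ is an isometric isomorphism of monoids. (2) There exists an isometric isomorphism of groups $T:(\overline{X},\overline{d})\to(\overline{Y},\overline{d'})$ such that $\Phi(f)=(\overline{f}\circ T^{-1})_{|Y}$ for all $f\in Lip^1_+(X)$, where $\overline{f}$ denotes the unique $1$-Lipschitz extension of $f$ to $\overline{X}$ and $(\overline{f}\circ T^{-1})_{|Y}$ denotes the restriction of $\overline{f}\circ T^{-1}$ to $Y$.
   Context: A metric group is a group equipped with a metric. A metric group $(X,d)$ is called invariant if $d(xy,xz)=d(yx,zx)=d(y,z)$ for all $x,y,z\in X$. Its group completion $(\overline{X},\overline{d})$ is the metric completion of $(X,d)$ equipped with the unique continuous extension of the group operation; it is again an invariant metric group, containing $X$ as a dense subgroup. For a metric space $(X,d)$, $Lip^1_+(X)$ denotes the set of all nonnegative $1$-Lipschitz functions $f:X\to\mathbb{R}$, equipped with the metric $\rho(f,g)=\sup_{x\in X}\frac{|f(x)-g(x)|}{1+|f(x)-g(x)|}$. For a group $X$ and functions $f,g:X\to\mathbb{R}$, the inf-convolution is $(f\oplus g)(x)=\inf\{f(y)+g(z): y,z\in X,\ yz=x\}$. For an invariant metric group $(X,d)$ with identity $e$, $(Lip^1_+(X),\oplus)$ is a monoid whose identity element is $\delta_e:x\mapsto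 d(x,e)$. An isometric isomorphism of monoids (resp. groups) is a bijective monoid (resp. group) homomorphism that preserves the given metrics. *)

(* Defs.v *)
From HB Require Import structures.
From mathcomp Require Import all_boot all_order all_algebra.
From mathcomp Require Import all_classical all_reals all_analysis.
From mathcomp Require Import ring lra.

Set Implicit Arguments.
Unset Strict Implicit.
Unset Printing Implicit Defensive.

Import Order.TTheory GRing.Theory Num.Theory.

Local Open Scope classical_set_scope.
Local Open Scope ring_scope.

#[short(type="metricMonoidType")]
HB.structure Definition MetricMonoid (R : numDomainType) :=
  {G of Metric R G & Monoid G}.

(* No compatibility between the metric and the group law is required here. *)
#[short(type="metricGroupType")]
HB.structure Definition MetricGroup (R : numDomainType) :=
  {G of Metric R G & Group G}.

HB.mixin Record MetricGroup_isInvariant (R : numDomainType) G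
    of MetricGroup R G := {
  mdist_mulgl : forall x y z : G, mdist (x * y)%g (x * z)%g = mdist y z ;
  mdist_mulgr : forall x y z : G, mdist (y * x)%g (z * x)%g = mdist y z
}.

#[short(type="invMetricGroupType")]
HB.structure Definition InvMetricGroup (R : numDomainType) :=
  {G of MetricGroup R G & MetricGroup_isInvariant R G}.

#[short(type="completeMetricGroupType")]
HB.structure Definition CompleteMetricGroup (R : numDomainType) :=
  {G of Complete G & MetricGroup R G}.

Definition isometry (R : numDomainType) (M N : metricType R) (f : M -> N) :=
  forall x y, mdist (f x) (f y) = mdist x y.

(* For groups, preservation of the unit follows from multiplicativity, so this
   also covers isometric isomorphisms of metric groups. *)
Definition isometric_isomorphism (R : numDomainType) (M N : metricMonoidType R)
    (f : M -> N) : Prop :=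
  [/\ bijective f, monoid.monoid_morphism f & isometry f].

(* A group completion is determined up to a unique isometric isomorphism under
   X, hence is given by its characterization rather than by one chosen model:
   a complete metric space containing X as a dense subgroup, with a continuous
   multiplication. Invariance of its metric is then a consequence. *)
Definition is_group_completion (R : numFieldType) (X : invMetricGroupType R)
    (Xb : completeMetricGroupType R) (i : X -> Xb) : Prop :=
  [/\ isometry i,
      {morph i : x y / (x * y)%g},
      dense (range i) &
      continuous (fun p : Xb * Xb => (p.1 * p.2)%g)].

Definition lip1 (R : numDomainType) (M : metricType R) (f : M -> R) : Prop :=
  forall x y, `|f x - f y| <= mdist x y.

Record lip1_plus (R : numDomainType) (M : metricType R) := Lip1Plus {
  lip1_plus_fun :> M -> R ;
  lip1_plus_ge0 : forall x, 0 <= lip1_plus_fun x ;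
  lip1_plus_lip1 : lip1 lip1_plus_fun
}.

HB.instance Definition _ (R : numDomainType) (M : metricType R) :=
  gen_eqMixin (lip1_plus M).
HB.instance Definition _ (R : numDomainType) (M : metricType R) :=
  gen_choiceMixin (lip1_plus M).

Lemma lip1_plus_inj (R : numDomainType) (M : metricType R)
  (f g : lip1_plus M) : f =1 g -> f = g.
Proof.
case: f g => [f f0 fl] [g g0 gl] /= /funext fg; subst g.
by congr Lip1Plus; exact: Prop_irrelevance.
Qed.

Section rho.
Context {R : realType} {M : invMetricGroupType R}.
Implicit Types f g h : lip1_plus M.

Definition rho f g : R :=
  sup (range (fun x => `|f x - g x| / (1 + `|f x - g x|))).

Let rho_bounded f g :
  has_ubound (range (fun x => `|f x - g x| / (1 + `|f x - g x|))).
Proof.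
exists 1 => _ [x _ <-]; have h : 0 <= `|f x - g x| by [].
by rewrite ler_pdivrMr; lra.
Qed.

Let le_rho f g x : `|f x - g x| / (1 + `|f x - g x|) <= rho f g.
Proof. by apply: ub_le_sup => //; exists x. Qed.

Let rho_le f g c :
  (forall x, `|f x - g x| / (1 + `|f x - g x|) <= c) -> rho f g <= c.
Proof.
move=> H; apply: ge_sup; first by eexists; exists 1%g.
by move=> _ [x _ <-]; exact: H.
Qed.

Let rhoxx f : rho f f = 0.
Proof.
apply/le_anti/andP; split.
  by apply: rho_le => x; rewrite subrr normr0 mul0r.
by rewrite (le_trans _ (le_rho f f 1%g))// subrr normr0 mul0r.
Qed.

Let rho_positivity f g : rho f g = 0 -> f = g.
Proof.
move=> fg; apply: lip1_plus_inj => x; have := le_rho f g x; rewrite fg.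
have h : 0 <= `|f x - g x| by [].
rewrite ler_pdivrMr ?mul0r; last by lra.
by rewrite normr_le0 subr_eq0 => /eqP.
Qed.

Let rho_sym f g : rho f g = rho g f.
Proof.
by rewrite /rho; congr sup; congr image; apply/funext => x; rewrite distrC.
Qed.

Let rho_triangle g f h : rho f h <= rho f g + rho g h.
Proof.
apply: rho_le => x; apply: le_trans (lerD (le_rho f g x) (le_rho g h x)).
have : `|f x - h x| <= `|f x - g x| + `|g x - h x| by exact: ler_distD.
move: (normr_ge0 (f x - h x)) (normr_ge0 (f x - g x)) (normr_ge0 (g x - h x)).
move: `|f x - h x| `|f x - g x| `|g x - h x| => a b c a0 b0 c0 abc.
have E (t : R) : 0 <= t -> t / (1 + t) = 1 - (1 + t)^-1.
  by move=> t0; field; apply/eqP; lra.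
have : (1 + (b + c))^-1 <= (1 + a)^-1 by rewrite lef_pV2 ?posrE; lra.
have -> : b / (1 + b) + c / (1 + c) =
    (b + c) / (1 + (b + c)) + b * c * (2 + b + c) /
    ((1 + b) * (1 + c) * (1 + (b + c))).
  by field; apply/and3P; split; apply/eqP; lra.
rewrite !E; [|lra|lra] => ac.
have : 0 <= b * c * (2 + b + c) / ((1 + b) * (1 + c) * (1 + (b + c))).
  by apply: divr_ge0; rewrite !mulr_ge0//; lra.
by lra.
Qed.

HB.instance Definition _ := isMetric.Build R (lip1_plus M)
  rhoxx rho_positivity rho_sym rho_triangle.

End rho.

Definition infconv (R : realType) (G : groupType) (f g : G -> R) (x : G) : R :=
  inf [set f p.1 + g p.2 | p in [set p : G * G | (p.1 * p.2)%g = x]].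

Section lip1_plus_monoid.
Context {R : realType} {X : invMetricGroupType R}.
Implicit Types f g h : lip1_plus X.

Let infconv_le f g y z : infconv f g (y * z)%g <= f y + g z.
Proof.
apply: ge_inf; last by exists (y, z).
by exists 0 => _ [p _ <-]; rewrite addr_ge0// lip1_plus_ge0.
Qed.

Let le_infconv (f g : X -> R) x c :
  (forall y z, (y * z)%g = x -> c <= f y + g z) -> c <= infconv f g x.
Proof.
move=> H; apply: lb_le_inf; last by move=> _ [[y z] /= yz <-]; exact: H.
by eexists; exists (x, 1%g) => //=; rewrite mulg1.
Qed.

Let infconv_ge0 f g x : 0 <= infconv f g x.
Proof. by apply: le_infconv => y z _; rewrite addr_ge0// lip1_plus_ge0. Qed.

Let infconv_lip1 f g : lip1 (infconv f g).
Proof.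
have H x x' : infconv f g x <= infconv f g x' + mdist x x'.
  rewrite -lerBlDr; apply: le_infconv => y z yz.
  have {1}-> : x = (y * (y^-1 * x))%g by rewrite mulgA mulgV mul1g.
  rewrite lerBlDr; apply: le_trans (infconv_le _ _ _ _) _.
  have := lip1_plus_lip1 g (y^-1 * x)%g z.
  rewrite -(mdist_mulgl y) mulgA mulgV mul1g yz => /ler_normlP[_].
  by lra.
move=> x y; rewrite ler_distl; have := H x y; have := H y x.
by rewrite (metric_sym y x) => a b; apply/andP; split; lra.
Qed.

Definition lip1_plus_mul f g : lip1_plus X :=
  Lip1Plus (infconv_ge0 f g) (@infconv_lip1 f g).

Let delta1_ge0 (x : X) : 0 <= mdist x 1%g. Proof. exact: mdist_ge0. Qed.

Let delta1_lip1 : lip1 (fun x : X => mdist x 1%g).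
Proof.
move=> x y; rewrite ler_distl.
have := metric_triangle x y 1%g; have := metric_triangle y x 1%g.
by rewrite (metric_sym y x) => a b; apply/andP; split; lra.
Qed.

Definition lip1_plus_one : lip1_plus X := Lip1Plus delta1_ge0 delta1_lip1.

Let mulA : associative lip1_plus_mul.
Proof.
move=> f g h; apply: lip1_plus_inj => x; apply/le_anti/andP; split.
- apply: le_infconv => y z <-; rewrite -lerBlDr; apply: le_infconv => a b <-.
  rewrite lerBlDr -mulgA; apply: le_trans (infconv_le _ (lip1_plus_mul g h) _ _) _.
  by rewrite -addrA lerD2l infconv_le.
- apply: le_infconv => y z <-; rewrite -lerBlDl; apply: le_infconv => a b <-.
  rewrite lerBlDl mulgA; apply: le_trans (infconv_le (lip1_plus_mul f g) _ _ _) _.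
  by rewrite addrA lerD2r infconv_le.
Qed.

Let mul1 : left_id lip1_plus_one lip1_plus_mul.
Proof.
move=> f; apply: lip1_plus_inj => x; apply/le_anti/andP; split.
  rewrite -{1}(mul1g x); apply: le_trans (infconv_le lip1_plus_one f _ _) _.
  by rewrite /= mdistxx add0r.
apply: le_infconv => y z <-; have := lip1_plus_lip1 f (y * z)%g z.
by rewrite -{4}(mul1g z) mdist_mulgr => /ler_normlP[_] /=; lra.
Qed.

Let mulr1 : right_id lip1_plus_one lip1_plus_mul.
Proof.
move=> f; apply: lip1_plus_inj => x; apply/le_anti/andP; split.
  rewrite -{1}(mulg1 x); apply: le_trans (infconv_le f lip1_plus_one _ _) _.
  by rewrite /= mdistxx addr0.
apply: le_infconv => y z <-; have := lip1_plus_lip1 f (y * z)%g y.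
by rewrite -{4}(mulg1 y) mdist_mulgl => /ler_normlP[_] /=; lra.
Qed.

HB.instance Definition _ := isMonoid.Build (lip1_plus X) mulA mul1 mulr1.

End lip1_plus_monoid.

(* The 1-Lipschitz g with g \o i = f, picked by choice; the next two lemmas
   show that it exists and is unique when i is isometric with dense range. *)
Definition lip1_extension (R : realType) (X Xb : metricType R) (i : X -> Xb)
    (f : X -> R) : Xb -> R :=
  xget (fun=> 0) [set g : Xb -> R | lip1 g /\ g \o i = f].

Lemma lip1_extensionP (R : realType) (X : invMetricGroupType R)
    (Xb : metricType R) (i : X -> Xb) (f : lip1_plus X) : isometry i ->
  lip1 (lip1_extension i f) /\ lip1_extension i f \o i = f.
Proof.
move=> isoi; rewrite /lip1_extension.
apply: (@xgetPex _ (fun=> 0) [set g : Xb -> R | lip1 g /\ g \o i = f]).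
pose S x := range (fun y => f y + mdist (i y) x).
have S0 x : S x !=set0 by eexists; exists 1%g.
have ubS x y : inf (S x) <= f y + mdist (i y) x.
  apply: ge_inf; last by exists y.
  by exists 0 => _ [z _ <-]; rewrite addr_ge0// ?lip1_plus_ge0// mdist_ge0.
exists (fun x => inf (S x)); split; last first.
  apply/funext => x /=; apply/le_anti/andP; split.
    by rewrite (le_trans (ubS _ x))// mdistxx addr0.
  apply: lb_le_inf => // _ [y _ <-]; rewrite isoi metric_sym.
  by have /ler_normlP[_] := lip1_plus_lip1 f x y; lra.
have H x x' : inf (S x) <= inf (S x') + mdist x x'.
  rewrite -lerBlDr; apply: lb_le_inf => // _ [y _ <-].
  have := ubS x y; have := metric_triangle (i y) x' x.
  by rewrite (metric_sym x' x); lra.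
move=> x y; rewrite ler_distl; have := H x y; have := H y x.
by rewrite (metric_sym y x) => a b; apply/andP; split; lra.
Qed.

Lemma lip1_extension_unique (R : realType) (X Xb : metricType R)
    (i : X -> Xb) (g h : Xb -> R) : dense (range i) ->
  lip1 g -> lip1 h -> g \o i = h \o i -> g = h.
Proof.
move=> di gl hl gh; apply/funext => x; apply/eqP; rewrite -subr_eq0 -normr_le0.
rewrite leNgt; apply/negP => e0.
have e2 : 0 < `|g x - h x| / 2 by rewrite divr_gt0.
have [|z [/interior_subset + [y _ yz]]] := di (ball x (`|g x - h x| / 2))° _
  (open_interior _).
  by exists x; exact: nbhsx_ballx.
rewrite -yz ballEmdist /= => xy.
have := gl x (i y); have := hl x (i y).
have -> : g (i y) = h (i y) := congr1 (fun k : X -> R => k y) gh.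
rewrite (distrC (h x)) => a b.
have := ler_distD (h (i y)) (g x) (h x).
by lra.
Qed.

(* Main.v *)
(** Extending functions to the completions preserves the infimal convolution
and rho, so X and Y may be assumed complete. Then the units of Lip^1_+(X) are
the functions delta_a = d(., a), and they form a group isometric to X up to
t |-> t / (1 + t); an isometric isomorphism Phi therefore induces T with
Phi(delta_a) = delta_(T a). Since f (+) delta_a is a translate of f, it remains
to see that Phi(f)(e) = f(e), and replacing Phi by its inverse, that
Phi(f)(e) <= f(e).

The constants are the functions fixed by the units, so Phi preserves them. The
function delta_e + c divides exactly the functions bounded below by c, which
forces Phi(delta_e + c) = delta_e + c, that is, Phi commutes with adding
constants. As rho encodes the sup distance, Phi then preserves the order between
functions at finite sup distance. Testing f <= f(e) + delta_e against bounded
functions h, i.e. f (+) h <= h + f(e), keeps all sup distances finite. *)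

Require Import Defs.
From mathcomp Require Import all_boot all_order all_algebra.
From mathcomp Require Import all_classical all_reals all_analysis.
From HB Require Import structures.
From mathcomp Require Import ring lra.

Set Implicit Arguments.
Unset Strict Implicit.
Unset Printing Implicit Defensive.

Import Order.TTheory GRing.Theory Num.Theory.
Import numFieldNormedType.Exports.

Local Open Scope classical_set_scope.
Local Open Scope ring_scope.

(** * Inverses and composites of isometric isomorphisms *)

Section isometric_isomorphism_theory.
Context {R : numDomainType}.

Lemma isometric_isomorphism_inv (M N : metricMonoidType R) (f : M -> N) :
  isometric_isomorphism f ->
  exists g : N -> M, [/\ isometric_isomorphism g, cancel f g & cancel g f].
Proof.
move=> [[g fK gK] [f1 fM] fd]; exists g; split=> //; split.
- by exists f.
- split=> [|x y]; first by rewrite -f1 fK.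
  by rewrite -{1}(gK x) -{1}(gK y) -fM fK.
- by move=> x y; rewrite -fd !gK.
Qed.

Lemma isometric_isomorphism_comp (L M N : metricMonoidType R)
    (f : M -> N) (g : L -> M) :
  isometric_isomorphism f -> isometric_isomorphism g ->
  isometric_isomorphism (f \o g).
Proof.
move=> [bf [f1 fM] fd] [bg [g1 gM] gd]; split; first exact: bij_comp.
  by split=> [|x y] /=; rewrite ?g1// gM fM.
by move=> x y /=; rewrite fd gd.
Qed.

End isometric_isomorphism_theory.

(** * Bounds for inf-convolutions and for [rho] *)

Section lip1_plus_theory.
Context {R : realType} {X : invMetricGroupType R}.
Implicit Types (f g h u v : lip1_plus X) (a b x y z : X) (c r : R).

Lemma lip1_plus_le f x y : f x <= f y + mdist x y.
Proof. by have /ler_normlP[_] := lip1_plus_lip1 f x y; lra. Qed.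

Lemma lip1_mul_le f g y z : (f * g)%g (y * z)%g <= f y + g z.
Proof.
apply: ge_inf; last by exists (y, z).
by exists 0 => _ [p _ <-]; rewrite addr_ge0// lip1_plus_ge0.
Qed.

Lemma le_lip1_mul f g x c :
  (forall y z, (y * z)%g = x -> c <= f y + g z) -> c <= (f * g)%g x.
Proof.
move=> H; apply: lb_le_inf; last by move=> _ [[y z] /= yz <-]; exact: H.
by eexists; exists (x, 1%g) => //=; rewrite mulg1.
Qed.

(* [t |-> t / (1 + t)] is an increasing bijection from [0, +oo[ onto [0, 1[. *)
Lemma rho_leP f g r : 0 <= r < 1 ->
  mdist f g <= r <-> forall x, `|f x - g x| <= r / (1 - r).
Proof.
move=> /andP[r0 r1].
have E x : (`|f x - g x| / (1 + `|f x - g x|) <= r) =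
    (`|f x - g x| <= r / (1 - r)).
  have t0 := normr_ge0 (f x - g x); move: `|f x - g x| t0 => t t0.
  rewrite ler_pdivrMr; last by lra.
  by rewrite ler_pdivlMr; last lra; apply/idP/idP; nra.
split=> [fgr x|fgr]; last first.
  apply: ge_sup; first by eexists; exists 1%g.
  by move=> _ [x _ <-]; rewrite E.
rewrite -E; apply: le_trans fgr; apply: ub_le_sup; last by exists x.
exists 1 => _ [y _ <-]; have t0 := normr_ge0 (f y - g y).
by rewrite ler_pdivrMr; lra.
Qed.

Lemma rho_le1 f g : mdist f g <= 1.
Proof.
apply: ge_sup; first by eexists; exists 1%g.
move=> _ [x _ <-]; have t0 := normr_ge0 (f x - g x).
by rewrite ler_pdivrMr; lra.
Qed.

End lip1_plus_theory.

(** * Isometries for [rho] and uniform bounds *)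

Section isometry_lip1_plus.
Context {R : realType} {X Y : invMetricGroupType R}.
Variable F : lip1_plus X -> lip1_plus Y.

(** Since [rho] is an increasing function of the sup distance, with value 1 when the latter is
    infinite, an isometry is a map that preserves and reflects every uniform bound. This form never
    mentions a possibly infinite supremum. *)
Lemma isometry_lip1P : Defs.isometry F <->
  forall (f g : lip1_plus X) (c : R),
  (forall x, `|f x - g x| <= c) <-> (forall y, `|F f y - F g y| <= c).
Proof.
split=> [dF f g c|FP f g].
  have [c0|c0] := leP 0 c; last first.
    have neg t : (`|t| <= c) = false :> bool.
      by apply/negbTE; rewrite -ltNge (lt_le_trans c0).
    by split=> /(_ 1%g); rewrite neg.
  have r01 : 0 <= c / (1 + c) < 1.
    apply/andP; split; first by rewrite divr_ge0//; lra.
    by rewrite ltr_pdivrMr; lra.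
  have <- : c / (1 + c) / (1 - c / (1 + c)) = c.
    by field; apply/andP; split; apply/eqP; lra.
  by rewrite -!rho_leP// dF.
(* Only levels below 1 encode finite uniform bounds; a distance that reaches 1 is handled at the end
   by [rho_le1]. *)
have {}FP r : r < 1 -> (mdist f g <= r) = (mdist (F f) (F g) <= r).
  have [r0 r1|r0 _] := leP 0 r; first apply/idP/idP.
  - by rewrite !rho_leP ?r0//; apply: (FP _ _ _).1.
  - by rewrite !rho_leP ?r0//; apply: (FP _ _ _).2.
  - have neg (M : invMetricGroupType R) (k l : lip1_plus M) :
        (mdist k l <= r) = false :> bool.
      by apply/negbTE; rewrite -ltNge (lt_le_trans r0)// mdist_ge0.
    by rewrite !neg.
apply/le_anti/andP; split.
  have [lt1|] := ltP (mdist f g) 1; first by rewrite -FP.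
  exact/le_trans/rho_le1.
have [lt1|] := ltP (mdist (F f) (F g)) 1; first by rewrite FP.
exact/le_trans/rho_le1.
Qed.

End isometry_lip1_plus.

(** * Shifts by constants, the functions [delta a], and units *)

Section shift_and_delta.
Context {R : realType} {X : invMetricGroupType R}.
Implicit Types (f g h u v : lip1_plus X) (a b x y z : X)
  (c : {nonneg R}) (r : R).

Let lip_shift_ge0 f c x : 0 <= f x + c%:num.
Proof. by rewrite addr_ge0// lip1_plus_ge0. Qed.

Let lip_shift_lip1 f c : lip1 (fun x => f x + c%:num).
Proof. by move=> x y; rewrite opprD addrACA subrr addr0 lip1_plus_lip1. Qed.

Definition lip_shift f c : lip1_plus X :=
  Lip1Plus (lip_shift_ge0 f c) (@lip_shift_lip1 f c).

Let lip_zero_lip1 : lip1 (fun _ : X => 0 : R).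
Proof. by move=> x y; rewrite subrr normr0 mdist_ge0. Qed.

Definition lip_zero : lip1_plus X :=
  Lip1Plus (fun x : X => lexx (0 : R)) lip_zero_lip1.

Let delta_lip1 a : lip1 (fun x => mdist x a).
Proof.
move=> x y; rewrite ler_distl.
have := metric_triangle x y a; have := metric_triangle y x a.
by rewrite (metric_sym y x) => ? ?; apply/andP; split; lra.
Qed.

Definition delta a : lip1_plus X :=
  Lip1Plus (fun x => mdist_ge0 x a) (@delta_lip1 a).

Lemma delta1 : delta 1%g = 1%g.
Proof. exact: lip1_plus_inj. Qed.

Lemma delta_inj : injective delta.
Proof.
move=> a b /(congr1 (fun f : lip1_plus X => f a)) /=.
by rewrite mdistxx => /esym/mdist_positivity.
Qed.

(** The factorisation of [x] with second factor [a] attains the infimum, because [f] is 1-Lipschitz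
    and the metric is invariant. Hence the [delta a] act by translations. *)
Lemma mul_delta f a x : (f * delta a)%g x = f (x * a^-1)%g.
Proof.
apply/le_anti/andP; split.
  have := lip1_mul_le f (delta a) (x * a^-1)%g a.
  by rewrite -mulgA mulVg mulg1 /= mdistxx addr0.
apply: le_lip1_mul => y z <-; apply: le_trans (lip1_plus_le f _ y) _.
rewrite -{3}(mulg1 y) -mulgA mdist_mulgl -(mdist_mulgr a).
by rewrite -mulgA mulVg mulg1 mul1g.
Qed.

Lemma deltaM a b : (delta a * delta b)%g = delta (a * b)%g.
Proof.
apply: lip1_plus_inj => x; rewrite mul_delta /=.
by rewrite -(mdist_mulgr b) -mulgA mulVg mulg1.
Qed.

(** The sup distance between [delta a] and [delta b] is attained at [a]; this lets a map on points
    inherit isometry from a map on functions. *)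
Lemma delta_leP a b r :
  (forall x, `|delta a x - delta b x| <= r) <-> mdist a b <= r.
Proof.
split=> [/(_ a)|abr x].
  by rewrite /= mdistxx sub0r normrN ger0_norm ?mdist_ge0.
apply: le_trans abr; rewrite /= !(metric_sym x).
rewrite ler_distl; have := metric_triangle a b x.
by have := metric_triangle b a x; rewrite (metric_sym b a) => ? ?;
  apply/andP; split; lra.
Qed.

Lemma mul_shift f g c : (f * lip_shift g c)%g = lip_shift (f * g)%g c.
Proof.
apply: lip1_plus_inj => x; apply/le_anti/andP; split => /=.
  rewrite -lerBlDr; apply: (@le_lip1_mul _ _ f g) => y z <-.
  by rewrite lerBlDr -addrA; apply: (@lip1_mul_le _ _ f (lip_shift g c)).
apply: (@le_lip1_mul _ _ f (lip_shift g c)) => y z <- /=.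
by rewrite addrA lerD2r (lip1_mul_le f g).
Qed.

Lemma shift_mul f g c : (lip_shift f c * g)%g = lip_shift (f * g)%g c.
Proof.
apply: lip1_plus_inj => x; apply/le_anti/andP; split => /=.
  rewrite -lerBlDr; apply: (@le_lip1_mul _ _ f g) => y z <-.
  by rewrite lerBlDr addrAC; apply: (@lip1_mul_le _ _ (lip_shift f c) g).
apply: (@le_lip1_mul _ _ (lip_shift f c) g) => y z <- /=.
by rewrite addrAC lerD2r (lip1_mul_le f g).
Qed.

Lemma lip_shift_inj c : injective (lip_shift ^~ c).
Proof.
move=> f g fg; apply: lip1_plus_inj => x.
by have := congr1 (fun h : lip1_plus X => h x) fg; apply: addIr.
Qed.

Lemma lip_shift_ex f c : (forall x, c%:num <= f x) ->
  exists g, f = lip_shift g c.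
Proof.
move=> cf; have g0 x : 0 <= f x - c%:num by rewrite subr_ge0.
have gl : lip1 (fun x : X => f x - c%:num).
  by move=> x y; rewrite opprB addrA subrK lip1_plus_lip1.
by exists (Lip1Plus g0 gl); apply: lip1_plus_inj => x /=; rewrite subrK.
Qed.

(** Translations act transitively on the group, which gives constancy a purely algebraic form. *)
Lemma const_translate f :
  (forall a, (f * delta a)%g = f) <-> forall x, f x = f 1%g.
Proof.
split=> [fa x|fx a].
  by rewrite -[in RHS](fa x^-1%g) mul_delta invgK mul1g.
by apply: lip1_plus_inj => x; rewrite mul_delta !fx.
Qed.

(** In a factorisation of [x] the second factor can be any [z]. With the next two lemmas,
    [lip_zero * f] is the constant function equal to the infimum of [f], so infima are visible to
    the monoid. *)
Lemma zero_mul_le f x z : (lip_zero * f)%g x <= f z.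
Proof.
have := lip1_mul_le lip_zero f (x * z^-1)%g z.
by rewrite -mulgA mulVg mulg1 /= add0r.
Qed.

Lemma le_zero_mul f x r : (forall z, r <= f z) -> r <= (lip_zero * f)%g x.
Proof.
by move=> rf; apply: le_lip1_mul => y z _; rewrite add0r.
Qed.

Lemma zero_mul_const f x : (lip_zero * f)%g x = (lip_zero * f)%g 1%g.
Proof.
by apply/le_anti/andP; split; apply: le_zero_mul => z; exact: zero_mul_le.
Qed.

(* The witness of the infimum defining [(u * v) 1 = 0]: [u] is within [e] of
   [delta y]. *)
Lemma unit_near_delta u v (e : R) : (u * v)%g = 1%g -> 0 < e ->
  exists y, u y < e /\ forall x, mdist x y < u x + e.
Proof.
move=> uv e0; have [[y [z [yz uvyz]]]|] :=
    pselect (exists y z, (y * z)%g = 1%g /\ u y + v z < e); last first.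
  move=> /forallNP H.
  suff : e <= (u * v)%g 1%g by rewrite uv /= mdistxx leNgt e0.
  by apply: le_lip1_mul => y z yz; rewrite leNgt; apply/negP => lte;
    apply: (H y); exists z.
have u0 := lip1_plus_ge0 u y; have v0 := lip1_plus_ge0 v z.
exists y; split; first by lra.
move=> x; have := lip1_mul_le u v x z; rewrite uv /= -(mdist_mulgr y).
have zy : (z * y)%g = 1%g.
  by move: yz => /(congr1 (fun t => y^-1 * t * y)%g); rewrite mulKg mulg1 mulVg.
by rewrite -mulgA zy mulg1 mul1g; lra.
Qed.

End shift_and_delta.

(** * Constants and lower bounds under an isomorphism *)

Section isomorphism_theory.
Context {R : realType} {X Y : invMetricGroupType R}.
Variable Phi : lip1_plus X -> lip1_plus Y.
Hypothesis Phi_iso : isometric_isomorphism Phi.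
Hypothesis Phi_delta : forall b, exists a, Phi (delta a) = delta b.
Implicit Types (f g : lip1_plus X) (c : R).

Let PhiM f g : Phi (f * g)%g = (Phi f * Phi g)%g.
Proof. by case: Phi_iso => _ [_ ->]. Qed.

Let Phi_lip f g c :
  (forall x, `|f x - g x| <= c) <-> (forall y, `|Phi f y - Phi g y| <= c).
Proof. by case: Phi_iso => _ _ /isometry_lip1P. Qed.

(** By [Phi_delta] every translation on the [Y] side is the image of one on the [X] side, so
    functions fixed by all translations go to such functions. *)
Lemma iso_const f : (forall x, f x = f 1%g) ->
  forall y, Phi f y = Phi f 1%g.
Proof.
move=> /const_translate fa; apply/const_translate => b.
by have [a <-] := Phi_delta b; rewrite -PhiM fa.
Qed.

(** [lip_zero] is idempotent, while a constant convolved with itself doubles; the image is thus an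
    idempotent constant, which must be zero. *)
Lemma iso_zero : Phi lip_zero = lip_zero.
Proof.
have z2 : (lip_zero * lip_zero)%g = lip_zero :> lip1_plus X.
  apply: lip1_plus_inj => x; apply/le_anti/andP; split.
    exact: (zero_mul_le lip_zero x 1%g).
  exact: lip1_plus_ge0.
have cst : forall y, Phi lip_zero y = Phi lip_zero 1%g by exact: iso_const.
apply: lip1_plus_inj => y /=; rewrite cst.
have : Phi lip_zero 1%g + Phi lip_zero 1%g <= Phi lip_zero 1%g.
  rewrite -{3}z2 PhiM; apply: le_lip1_mul => a b _.
  by rewrite (cst a) (cst b).
by have := lip1_plus_ge0 (Phi lip_zero) 1%g; lra.
Qed.

(** A constant is determined by its sup distance to [lip_zero], which [Phi] fixes. *)
Lemma iso_eq_const f c : (forall x, f x = c) -> forall y, Phi f y = c.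
Proof.
move=> fc; have c0 : 0 <= c by rewrite -(fc 1%g) lip1_plus_ge0.
have Pf : forall y, Phi f y = Phi f 1%g by apply: iso_const => x; rewrite !fc.
have P0 := lip1_plus_ge0 (Phi f) 1%g.
move=> y; rewrite Pf; apply/le_anti/andP; split.
  have /Phi_lip/(_ 1%g) : forall x, `|f x - lip_zero x| <= c.
    by move=> x; rewrite fc subr0 ger0_norm.
  by rewrite iso_zero subr0 ger0_norm.
have /Phi_lip/(_ 1%g) :
    forall z, `|Phi f z - Phi lip_zero z| <= Phi f 1%g.
  by move=> z; rewrite iso_zero subr0 Pf ger0_norm.
by rewrite fc subr0 ger0_norm.
Qed.

(** The infimum of [f] is the value of the constant [lip_zero * f], which [Phi] preserves. *)
Lemma iso_ge f c : (forall x, c <= f x) -> forall y, c <= Phi f y.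
Proof.
move=> cf y; apply: le_trans (zero_mul_le (Phi f) y y).
have -> : (lip_zero * Phi f)%g = Phi (lip_zero * f)%g by rewrite PhiM iso_zero.
rewrite (iso_eq_const (c := (lip_zero * f)%g 1%g)); first exact: le_zero_mul.
exact: zero_mul_const.
Qed.

End isomorphism_theory.

(** * Shifts, order and the value at the identity *)

Section isomorphism_order.
Context {R : realType} {X Y : invMetricGroupType R}.
Variables (Phi : lip1_plus X -> lip1_plus Y) (Psi : lip1_plus Y -> lip1_plus X).
Hypotheses (Phi_iso : isometric_isomorphism Phi)
  (Psi_iso : isometric_isomorphism Psi).
Hypotheses (PhiK : cancel Phi Psi) (PsiK : cancel Psi Phi).
Hypotheses (Phi_delta : forall b, exists a, Phi (delta a) = delta b)
  (Psi_delta : forall a, exists b, Psi (delta b) = delta a).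
Implicit Types (f g : lip1_plus X) (c : {nonneg R}).

Let PhiM f g : Phi (f * g)%g = (Phi f * Phi g)%g.
Proof. by case: Phi_iso => _ [_ ->]. Qed.

Let Phi1 : Phi 1%g = 1%g.
Proof. by case: Phi_iso => _ [-> _]. Qed.

Let Phi_lip f g (r : R) :
  (forall x, `|f x - g x| <= r) <-> (forall y, `|Phi f y - Phi g y| <= r).
Proof. by case: Phi_iso => _ _ /isometry_lip1P. Qed.

(* With [1 = delta_e]: [Phi (1 + c)] and [1 + c] divide each other, so they
   differ by a unit [g]; since [Phi (1 + c)] is within [c] of [1], this unit
   vanishes at the identity, hence is trivial. *)
Lemma iso_shift1 c : Phi (lip_shift 1%g c) = lip_shift 1%g c.
Proof.
have ge1 (Z : invMetricGroupType R) (x : Z) :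
    c%:num <= (lip_shift 1%g c : lip1_plus Z) x.
  by rewrite /= lerDr mdist_ge0.
have [g Pg] := lip_shift_ex (iso_ge Phi_iso Phi_delta (ge1 X)).
have [k Pk] := lip_shift_ex (iso_ge Psi_iso Psi_delta (ge1 Y)).
have gk : (g * Phi k)%g = 1%g.
  apply: (@lip_shift_inj _ _ c); rewrite -shift_mul -Pg -PhiM shift_mul mul1g.
  by rewrite -Pk PsiK.
have g1 : g 1%g = 0.
  have /Phi_lip/(_ 1%g) :
      forall x, `|lip_shift 1%g c x - (1%g : lip1_plus X) x| <= c%:num.
    by move=> x; rewrite /= addrAC subrr add0r ger0_norm.
  rewrite Phi1 Pg /= mdistxx subr0 => /ler_normlP[_].
  by have := lip1_plus_ge0 g 1%g; lra.
rewrite Pg; congr lip_shift; apply: lip1_plus_inj => y; apply/le_anti/andP.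
split; first by rewrite /= -[leRHS]add0r -g1 lip1_plus_le.
apply/ler_addgt0Pr => e e0; have e2 : 0 < e / 2 by lra.
(* As [g 1 = 0], the point [z] lies within [e / 2] of the identity; replacing [z] by the identity
   costs the other [e / 2]. *)
have [z [_ zg]] := unit_near_delta gk e2.
have := zg 1%g; have := zg y; rewrite g1 /=.
by have := metric_triangle y z 1%g; rewrite (metric_sym z); lra.
Qed.

Lemma iso_shift f c : Phi (lip_shift f c) = lip_shift (Phi f) c.
Proof. by rewrite -{1}[f]mulg1 -mul_shift PhiM iso_shift1 mul_shift mulg1. Qed.

(* Adding a large constant turns the sup distance into a one-sided bound. *)
Lemma iso_le f g (M c : {nonneg R}) : (forall x, `|f x - g x| <= M%:num) ->
  (forall x, f x <= g x + c%:num) -> forall y, Phi f y <= Phi g y + c%:num.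
Proof.
move=> fgM fgc y.
have /Phi_lip/(_ y) : forall x, `|lip_shift f M x - g x| <= M%:num + c%:num.
  move=> x; have /ler_normlP[? ?] := fgM x; have := fgc x.
  have : 0 <= c%:num by [].
  by rewrite /= ler_distl => ? ?; apply/andP; split; lra.
by rewrite iso_shift => /ler_normlP[_] /=; lra.
Qed.

(* [f * h <= f 1 + h] for every [h]; when [h] is bounded this is an inequality
   at finite distance, which [Phi] preserves. Take for [Phi h] the truncation of
   [1] at height [Phi f 1]. *)
Lemma iso_le1 f : Phi f 1%g <= f 1%g.
Proof.
pose N := Phi f 1%g; have N0 : 0 <= N by exact: lip1_plus_ge0.
have h0 y : 0 <= Num.min (mdist y (1%g : Y)) N by rewrite le_min mdist_ge0.
have hl : lip1 (fun y : Y => Num.min (mdist y 1%g) N).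
  move=> y z; have := lip1_plus_lip1 (1%g : lip1_plus Y) y z => /=.
  have := mdist_ge0 y z; rewrite !ler_distl !minEle.
  by case: ifPn; case: ifPn; rewrite -?ltNge; lra.
pose h' := Lip1Plus h0 hl; pose h := Psi h'.
have Ph : Phi h = h' by exact: PsiK.
have hN x : h x <= N.
  have /Phi_lip/(_ x) : forall y, `|Phi h y - Phi lip_zero y| <= N.
    move=> y; rewrite (iso_zero Phi_iso Phi_delta) Ph subr0 ger0_norm//=.
    by rewrite ge_min lexx orbT.
  by rewrite subr0 ger0_norm ?lip1_plus_ge0.
have f0 := lip1_plus_ge0 f 1%g.
have fh x : (f * h)%g x <= h x + f 1%g.
  by rewrite addrC -{1}(mul1g x) lip1_mul_le.
have fhM x : `|(f * h)%g x - h x| <= f 1%g + N.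
  have := fh x; have := hN x; have := lip1_plus_ge0 h x.
  have := lip1_plus_ge0 (f * h)%g x.
  by rewrite ler_distl => ? ? ? ?; apply/andP; split; lra.
have := iso_le (M := NngNum (addr_ge0 f0 N0)) (c := NngNum f0) fhM fh 1%g.
rewrite PhiM Ph /= mdistxx min_l// add0r; apply: le_trans.
(* If the truncation at [z] equals [N], nonnegativity of [Phi f] suffices; otherwise it is the
   distance from [y] to the identity, and the Lipschitz bound applies. *)
apply: (@le_lip1_mul _ _ (Phi f) h') => y z yz /=; rewrite -/N.
have yz1 : mdist 1%g y = mdist z 1%g by rewrite -(mdist_mulgl y z) yz mulg1.
have := lip1_plus_le (Phi f) 1%g y; rewrite yz1 -/N.
have := lip1_plus_ge0 (Phi f) y; rewrite minEle.
by case: ifPn => _; lra.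
Qed.

End isomorphism_order.

(** * Units and isomorphisms for complete groups *)

Section complete_case.
Context {R : realType}.

Definition cauchy_complete (M : uniformType) : Prop :=
  forall F : set_system M, ProperFilter F -> cauchy F -> exists x : M, F --> x.

(** Points where [u] is nearly zero form a Cauchy sequence, and [u] is the distance to its limit. *)
Lemma unit_delta (X : invMetricGroupType R) (u v : lip1_plus X) :
  cauchy_complete X -> (u * v)%g = 1%g -> exists a, u = delta a.
Proof.
move=> X_complete uv; pose e (n : nat) : R := n.+1%:R^-1.
have e0 n : 0 < e n by rewrite invr_gt0.
have [y yP] := choice (fun n => unit_near_delta uv (e0 n)) => {uv}.
have e_small (r : R) : 0 < r -> \forall n \near \oo, e n < r.
  by move=> r0; exact: (near_infty_natSinv_lt (PosNum r0)).
have [a ya] : exists a : X, y @ \oo --> a.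
  apply: X_complete.
  apply: cauchy_exP => r r0; have r2 : 0 < r / 2 by lra.
  have [N _ eN] := e_small _ r2; exists (y N); exists N => // n /= Nn.
  (* The distance from [y n] to [y N] is below [u (y n) + e N], hence below [e n + e N]. *)
  have [uN _] := yP n; have [_ /(_ (y n))] := yP N.
  have := eN _ Nn; have := eN N (leqnn N).
  by rewrite ballEmdist /= metric_sym; lra.
exists a; apply: lip1_plus_inj => x /=.
have near (r : R) : 0 < r -> exists n, e n < r / 2 /\ mdist a (y n) < r / 2.
  move=> r0; have r2 : 0 < r / 2 by lra.
  have ya_r : \forall n \near \oo, mdist a (y n) < r / 2.
    exact: metricType_numDomainType.cvgr_dist_lt ya _ r2.
  exact: filter_ex (filterI (e_small _ r2) ya_r).
apply/le_anti/andP; split; apply/ler_addgt0Pr => r /near[n [en an]].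
  have := lip1_plus_le u x (y n); have := metric_triangle x a (y n).
  have [+ _] := yP n; move: en an.
  by move: (e n) (mdist x (y n)) (mdist a (y n)) (u x) (u (y n)) (mdist x a);
    move=> *; lra.
have := metric_triangle x (y n) a; rewrite (metric_sym (y n)).
have [_ /(_ x)] := yP n; move: en an.
by move: (e n) (mdist x (y n)) (mdist a (y n)) (u x) (u (y n)) (mdist x a);
  move=> *; lra.
Qed.

Lemma iso_delta (X Y : invMetricGroupType R)
    (Phi : lip1_plus X -> lip1_plus Y) :
  cauchy_complete Y -> isometric_isomorphism Phi ->
  forall a, exists b, Phi (delta a) = delta b.
Proof.
move=> Y_complete [_ [Phi1 PhiM] _] a.
apply: (@unit_delta _ _ (Phi (delta a^-1%g)))=> //.
by rewrite -PhiM deltaM mulgV delta1 Phi1.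
Qed.

(** [T] and its inverse are read off from the action of [Phi] and [Psi] on the units [delta a]. *)
Lemma iso_pullback (X Y : invMetricGroupType R)
    (Phi : lip1_plus X -> lip1_plus Y) :
  cauchy_complete X -> cauchy_complete Y -> isometric_isomorphism Phi ->
  exists (T : X -> Y) (Tinv : Y -> X),
    [/\ isometric_isomorphism T, cancel T Tinv, cancel Tinv T &
        forall f y, Phi f y = f (Tinv y)].
Proof.
move=> X_complete Y_complete Phi_iso.
have [Psi [Psi_iso PhiK PsiK]] := isometric_isomorphism_inv Phi_iso.
have [T TP] := choice (iso_delta Y_complete Phi_iso).
have [S SP] := choice (iso_delta X_complete Psi_iso).
have TK : cancel T S by move=> a; apply: delta_inj; rewrite -SP -TP PhiK.
have SK : cancel S T by move=> b; apply: delta_inj; rewrite -TP -SP PsiK.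
have [_ [Phi1 PhiM] /isometry_lip1P Phi_lip] := Phi_iso.
have TM : {morph T : x y / (x * y)%g}.
  by move=> a b; apply: delta_inj; rewrite -TP -!deltaM PhiM !TP.
have T1 : T 1%g = 1%g by apply: delta_inj; rewrite -TP !delta1.
have TV a : T a^-1%g = (T a)^-1%g.
  by apply: (mulgI (T a)); rewrite -TM !mulgV.
have Phi_delta b : exists a, Phi (delta a) = delta b.
  by exists (S b); rewrite TP SK.
have Psi_delta a : exists b, Psi (delta b) = delta a.
  by exists (T a); rewrite SP TK.
have Phi_at1 f : Phi f 1%g = f 1%g.
  apply/le_anti/andP; split; first exact: (iso_le1 Phi_iso Psi_iso).
  by rewrite -{1}(PhiK f); exact: (iso_le1 Psi_iso Phi_iso).
exists T, S; split=> //; first split=> //; first by exists S.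
- move=> a b; have dT r : mdist (T a) (T b) <= r <-> mdist a b <= r.
    by split=> /delta_leP H; apply/delta_leP; move: H; rewrite -!TP => /Phi_lip.
  by apply/le_anti/andP; split; [apply/dT | rewrite -dT].
(* This translate of [f] takes the value [f (S y)] at the identity, and its image takes the value
   [Phi f y] there. *)
- move=> f y; have := Phi_at1 (f * delta (S y)^-1)%g.
  by rewrite PhiM TP !mul_delta TV SK !invgK !mul1g.
Qed.

End complete_case.

(** * Restriction to a dense subgroup *)

Section dense_subgroup.
Context {R : realType}.

Lemma dense_mdist (M N : metricType R) (i : M -> N) (z : N) (e : R) :
  dense (range i) -> 0 < e -> exists x, mdist z (i x) < e.
Proof.
move=> di e0; have [|t [/interior_subset zt [x _ xt]]] := di (ball z e)° _
  (open_interior _).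
  by exists z; exact: nbhsx_ballx.
by exists x; move: zt; rewrite -xt ballEmdist.
Qed.

Context {X Z : invMetricGroupType R} {i : X -> Z}.
Hypothesis i_isom : Defs.isometry i.

Let restrict_ge0 (f : lip1_plus Z) x : 0 <= f (i x).
Proof. exact: lip1_plus_ge0. Qed.

Let restrict_lip1 (f : lip1_plus Z) : lip1 (f \o i).
Proof. by move=> x y; rewrite -i_isom lip1_plus_lip1. Qed.

Definition lip_restrict (f : lip1_plus Z) : lip1_plus X :=
  Lip1Plus (restrict_ge0 f) (@restrict_lip1 f).

Hypotheses (iM : {morph i : x y / (x * y)%g}) (i_dense : dense (range i)).

Let lip_extension_ge0 (f : lip1_plus X) z : 0 <= lip1_extension i f z.
Proof.
have [fl fi] := lip1_extensionP f i_isom.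
apply/ler_addgt0Pr => e e0; have [x zx] := dense_mdist z i_dense e0.
have fix0 : 0 <= lip1_extension i f (i x).
  by rewrite -[leRHS]/((_ \o i) x) fi lip1_plus_ge0.
by have /ler_normlP[] := fl z (i x); lra.
Qed.

Definition lip_extension (f : lip1_plus X) : lip1_plus Z :=
  Lip1Plus (lip_extension_ge0 f) (lip1_extensionP f i_isom).1.

Lemma lip_extensionK : cancel lip_extension lip_restrict.
Proof.
move=> f; apply: lip1_plus_inj => x /=.
exact: (congr1 (@^~ x) (lip1_extensionP f i_isom).2).
Qed.

Lemma lip_restrictK : cancel lip_restrict lip_extension.
Proof.
move=> f; apply: lip1_plus_inj => z; apply: (congr1 (@^~ z)).
apply: (lip1_extension_unique i_dense); [exact: lip1_plus_lip1..|].
by have [_ ->] := lip1_extensionP (lip_restrict f) i_isom.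
Qed.

(** Multiplicativity is the delicate point: the infimum over factorisations in [Z] must be
    approached by factorisations in [X]. *)
Lemma lip_restrict_iso : isometric_isomorphism lip_restrict.
Proof.
have i1 : i 1%g = 1%g by apply: (mulgI (i 1%g)); rewrite -iM !mulg1.
have iV x : i x^-1%g = (i x)^-1%g.
  by apply: (mulgI (i x)); rewrite -iM !mulgV.
split.
- by exists lip_extension; [exact: lip_restrictK | exact: lip_extensionK].
- split=> [|f g]; apply: lip1_plus_inj => x; first by rewrite /= -i1 i_isom.
  apply/le_anti/andP; split; apply: le_lip1_mul => y z.
    by move=> <-; rewrite /= iM; exact: (lip1_mul_le f g).
  move=> yz; apply/ler_addgt0Pr => e e0; have e2 : 0 < e / 2 by lra.
  (* Moving [y] to [i a] forces the second factor to be the image of [a^-1 * x]; by invariance it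
     moves by the same distance, so each factor costs at most [e / 2]. *)
  have [a ya] := dense_mdist y i_dense e2.
  have := lip1_mul_le (lip_restrict f) (lip_restrict g) a (a^-1 * x)%g.
  rewrite mulVKg /= iM iV -yz.
  have := lip1_plus_le f (i a) y.
  have := lip1_plus_le g ((i a)^-1 * (y * z))%g z.
  rewrite -(mdist_mulgl (i a)) mulVKg mdist_mulgr.
  by move: ya; rewrite (metric_sym y); lra.
- apply/isometry_lip1P => f g c; split=> [fg x|fg z]; first exact: fg.
  apply/ler_addgt0Pr => e e0; have e2 : 0 < e / 2 by lra.
  have [x zx] := dense_mdist z i_dense e2.
  have /ler_normlP[? ?] : `|f (i x) - g (i x)| <= c := fg x.
  have /ler_normlP[? ?] := lip1_plus_lip1 f z (i x).
  have /ler_normlP[? ?] := lip1_plus_lip1 g z (i x).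
  by apply/ler_normlP; split; lra.
Qed.

End dense_subgroup.

(** * Extension of metric identities by density *)

Section metric_continuity.
Context {R : realType}.

Lemma continuous_mdist (T : topologicalType) (M : metricType R) (f g : T -> M) :
  continuous f -> continuous g -> continuous (fun t => mdist (f t) (g t) : R).
Proof.
move=> fc gc t; apply/cvgrPdist_lt => e e0; have e2 : 0 < e / 2 by lra.
have ft : \forall s \near t, mdist (f t) (f s) < e / 2.
  exact: metricType_numDomainType.cvgr_dist_lt (fc t) _ e2.
have gt : \forall s \near t, mdist (g t) (g s) < e / 2.
  exact: metricType_numDomainType.cvgr_dist_lt (gc t) _ e2.
apply: filterS2 ft gt => s fs gs; rewrite ltr_distl.
have := metric_triangle (f t) (f s) (g t).
have := metric_triangle (f s) (f t) (g s).
have := metric_triangle (f s) (g s) (g t).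
have := metric_triangle (f t) (g t) (g s).
rewrite (metric_sym (f s) (f t)) (metric_sym (g s) (g t)).
by move=> *; apply/andP; split; lra.
Qed.

Lemma continuous_dense_eq (X : Type) (T : topologicalType) (i : X -> T)
    (f g : T -> R) :
  dense (range i) -> continuous f -> continuous g -> f \o i =1 g \o i -> f =1 g.
Proof.
move=> di fc gc fg t; apply/eqP/negPn/negP => neq.
have [||s [/= fgs [x _ xs]]] := di ((f \- g) @^-1` [set r | r != 0]).
- by exists t; rewrite /= subr_eq0.
- by apply: open_comp (@open_neq R 0) => s _; exact: cvgB (fc s) (gc s).
- by move: fgs; rewrite -xs; have /= -> := fg x; rewrite subrr eqxx.
Qed.

(** The identity passes to the closure in one variable at a time. A general [op] covers both the
    product and the reversed product, hence left and right invariance. *)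
Lemma continuous_dense_isometry (X : Type) (M : metricType R) (i : X -> M)
    (op : M -> M -> M) :
  dense (range i) -> continuous (fun p : M * M => op p.1 p.2) ->
  (forall a x y, mdist (op (i a) (i x)) (op (i a) (i y)) = mdist (i x) (i y)) ->
  forall a, Defs.isometry (op a).
Proof.
move=> di opc opi.
have opl a : continuous (op a).
  move=> t; apply: (continuous_comp (f := fun s => (a, s))) (opc (a, t)).
  by apply: cvg_pair; [exact: cvg_cst | exact: cvg_id].
have opr a : continuous (op ^~ a).
  move=> t; apply: (continuous_comp (f := fun s => (s, a))) (opc (t, a)).
  by apply: cvg_pair; [exact: cvg_id | exact: cvg_cst].
have idc : continuous (fun t : M => t) by move=> t; exact: cvg_id.
have cstc (a : M) : continuous (fun _ : M => a) by move=> t; exact: cvg_cst.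
move=> a x y; move: a; apply: (continuous_dense_eq di).
- exact: continuous_mdist.
- by move=> t; exact: cvg_cst.
move=> a /=; move: x; apply: (continuous_dense_eq di).
- exact: continuous_mdist.
- exact: continuous_mdist.
move=> x /=; move: y; apply: (continuous_dense_eq di).
- exact: continuous_mdist.
- exact: continuous_mdist.
by move=> y /=.
Qed.

End metric_continuity.

(** * The completion as an invariant metric group *)

Section completion.
Context {R : realType} {X : invMetricGroupType R}
  {Xb : completeMetricGroupType R} {i : X -> Xb}.

(* An alias of [Xb] carrying the proof from which the invariance of its metric
   is derived, so that this invariance can be a canonical instance. *)
Definition completion (_ : is_group_completion i) : Type := Xb.

Variable iP : is_group_completion i.

HB.instance Definition _ := CompleteMetricGroup.on (completion iP).

Let completion_mulgl (x y z : completion iP) :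
  mdist (x * y)%g (x * z)%g = mdist y z.
Proof.
have [isoi iM di mulc] := iP.
apply: (continuous_dense_isometry (op := fun a b : Xb => (a * b)%g) di mulc).
by move=> a b c; rewrite -!iM !isoi mdist_mulgl.
Qed.

Let completion_mulgr (x y z : completion iP) :
  mdist (y * x)%g (z * x)%g = mdist y z.
Proof.
have [isoi iM di mulc] := iP.
apply: (continuous_dense_isometry (op := fun a b : Xb => (b * a)%g) di).
  by move=> p; exact: (continuous_comp (@swap_continuous Xb Xb p) (mulc _)).
by move=> a b c; rewrite -!iM !isoi mdist_mulgr.
Qed.

HB.instance Definition _ :=
  MetricGroup_isInvariant.Build R (completion iP)
    completion_mulgl completion_mulgr.

Lemma completion_complete : cauchy_complete (completion iP).
Proof. by move=> F PF /cauchy_cvg/cvg_ex. Qed.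

End completion.

(** * Passage between the groups and their completions *)

Theorem theorem1 (R : realType) (X Y : invMetricGroupType R)
    (Xb Yb : completeMetricGroupType R) (iX : X -> Xb) (iY : Y -> Yb)
    (hX : is_group_completion iX) (hY : is_group_completion iY)
    (Phi : lip1_plus X -> lip1_plus Y) :
  isometric_isomorphism Phi <->
  exists (T : Xb -> Yb) (Tinv : Yb -> Xb),
    [/\ isometric_isomorphism T, cancel T Tinv, cancel Tinv T &
        forall f : lip1_plus X,
          Phi f = lip1_extension iX f \o Tinv \o iY :> (Y -> R)].
Proof.
have [X_isom XM X_dense _] := hX; have [Y_isom YM Y_dense _] := hY.
pose rX := @lip_restrict R X (completion hX) iX X_isom.
pose eX := @lip_extension R X (completion hX) iX X_isom X_dense.
pose rY := @lip_restrict R Y (completion hY) iY Y_isom.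
pose eY := @lip_extension R Y (completion hY) iY Y_isom Y_dense.
have rX_iso : isometric_isomorphism rX by exact: lip_restrict_iso.
have rY_iso : isometric_isomorphism rY by exact: lip_restrict_iso.
have inverse_iso (M N : metricMonoidType R) (r : M -> N) e :
    isometric_isomorphism r -> cancel r e -> cancel e r ->
    isometric_isomorphism e.
  move=> /isometric_isomorphism_inv[e' [e'_iso re' _]] re er.
  by suff -> : e = e' by []; apply/funext => n; rewrite -[n]er re re'.
split=> [Phi_iso|[T [Tinv [T_iso TK SK PhiE]]]].
(* Conjugating [Phi] by restriction and extension gives an isomorphism over the completions, where
   [iso_pullback] applies. *)
- have F_iso : isometric_isomorphism (eY \o (Phi \o rX)).
    apply: isometric_isomorphism_comp.
      by apply: (inverse_iso _ _ rY) => //;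
        [exact: lip_restrictK | exact: lip_extensionK].
    exact: isometric_isomorphism_comp.
  have [T [S [T_iso TK SK FE]]] := iso_pullback
    (@completion_complete _ _ _ _ hX) (@completion_complete _ _ _ _ hY) F_iso.
  exists T, S; split=> // f; apply/funext => y.
  have <- : rY (eY (Phi f)) = Phi f by exact: lip_extensionK.
  have {1}<- : rX (eX f) = f by exact: lip_extensionK.
  exact: FE.
- have S_iso : isometric_isomorphism Tinv.
    exact: (inverse_iso _ _ T).
  have [_ [_ SM] S_isom] := S_iso.
  (* Composition with [Tinv] is treated as restriction along an isometric morphism with dense range,
     so that [lip_restrict_iso] applies to it as well. *)
  have S_dense : dense (range Tinv).
    by move=> A [x Ax] _; exists x; split=> //; exists (T x).
  pose F := @lip_restrict R (completion hY) (completion hX) Tinv S_isom.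
  have F_iso : isometric_isomorphism F by exact: lip_restrict_iso.
  have -> : Phi = rY \o (F \o eX).
    apply/funext => f; apply: lip1_plus_inj => y.
    exact: (congr1 (@^~ y) (PhiE f)).
  apply: isometric_isomorphism_comp => //.
  apply: isometric_isomorphism_comp => //.
  by apply: (inverse_iso _ _ rX) => //;
    [exact: lip_restrictK | exact: lip_extensionK].
Qed.
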